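(* Let $L$ be a closed linear operator on a complex Hilbert space $H$ satisfying the standing assumptions listed in the context, with linearly independent slow eigenvectors $\hat{x}_1,\dots,\hat{x}_n$, $L\hat{x}_j=\lambda_j\hat{x}_j$. Let $G$ be the $n\times n$ matrix with entries $G_{ij}=\dfrac{\langle\hat{x}_i,\hat{x}_j\rangle}{\lambda_i+\lambda_j^*}$, $1\le i,j\le n$, and define the linear operator $\mathbb{P}_{\rm DOP}:H\to H$ by $$\mathbb{P}_{\rm DOP}\,x=\sum_{i=1}^n\sum_{j=1}^n\hat{x}_i\left[(G^{T})^{-1}\right]_{ij}\big\langle (L+\lambda_j^* )^{-1}x,\hat{x}_j\big\rangle,\qquad x\in H.$$ Then $\mathbb{P}_{\rm DOP}$ is a projection: $$\mathbb{P}_{\rm DOP}^2=\mathbb{P}_{\rm DOP}.$$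
   Context: $H$ is a complex Hilbert space with inner product $\langle\cdot,\cdot\rangle$, linear in the first argument and conjugate-linear in the second, and norm $\|\cdot\|$. A star denotes complex conjugation of scalars, and $G^T$ is the (non-conjugated) transpose. For a scalar $\mu$, $L+\mu$ means $L+\mu\,\mathrm{Id}$. Standing assumptions on $L$: $L$ is a closed linear operator on $H$ generating a strongly continuous semigroup $(e^{tL})_{t\ge0}$ which is exponentially stable. Its spectrum satisfies $\Re\,\mathrm{spec}(L)<0$ and $\mathrm{spec}(L)=\mathrm{spec}_{\rm ess}(L)\cup\{\lambda_j\}_{1\le j\le n}$, where $n$ is finite, the $\lambda_j$ are isolated eigenvalues of finite multiplicity (counted with multiplicity, ordered so that $\Re\lambda_i\le\Re\lambda_j$ for $i<j$), and every point of the essential spectrum $\mathrm{spec}_{\rm ess}(L)$ (which may be empty) has real part strictly smaller than $\Re\lambda_j$ for all $j$. The restriction of $L$ to the space associated with the eigenvalues $\lambda_j$ is diagonalizable (no nontrivial Jordan blocks), and $\hat{x}_1,\dots,\hat{x}_n$ are corresponding linearly independent eigenvectors, $L\hat{x}_j=\lambda_j\hat{x}_j$ (the ''slow modes''). Their span is called the slow manifold. Since $\Re\,\mathrm{spec}(L)<0$, the number $-\lambda_j^*$ lies in the resolvent set of $L$, so $(L+\lambda_j^* )^{-1}$ is a bounded operator on $H$. Under these assumptions the matrix $G$ is invertible, so $\mathbb{P}_{\rm DOP}$ (the ''dynamically optimal projection'') is well defined. *)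

(* Defs.v *)
From HB Require Import structures.
From mathcomp Require Import all_boot all_order all_algebra.
From mathcomp Require Import all_classical all_reals all_analysis.
From mathcomp Require Import complex.
Set Implicit Arguments.
Unset Strict Implicit.
Unset Printing Implicit Defensive.
Import Order.TTheory GRing.Theory Num.Theory.
Import numFieldNormedType.Exports.
Local Open Scope classical_set_scope.
Local Open Scope ring_scope.
Local Open Scope complex_scope.

(* MathComp-Analysis has no Hilbert space structure. A complex Hilbert space is
   a complete normed module H over R[i] with a positive definite Hermitian form
   dot : {dot H for Num.conj}, linear on the left and conjugate-linear on the
   right, that induces the norm. *)
Definition induces_norm (R : realType) (H : completeNormedModType R[i])
    (dot : {dot H for Num.conj}) : Prop :=
  forall x : H, `|x| ^+ 2 = dot x x.

(* Linear operators with a domain; the values of op outside dom are irrelevant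
   to every definition below. *)
Record operator (R : realType) (H : completeNormedModType R[i]) := Operator {
  dom : set H ;
  op :> H -> H ;
  dom0 : dom 0 ;
  domP : forall (a : R[i]) x y, dom x -> dom y -> dom (a *: x + y) ;
  opP : forall (a : R[i]) x y, dom x -> dom y ->
    op (a *: x + y) = a *: op x + op y
}.

Definition closed_operator (R : realType) (H : completeNormedModType R[i])
    (L : operator H) : Prop :=
  closed [set p : H * H | dom L p.1 /\ L p.1 = p.2].

(* Only the times t >= 0 are relevant. *)
Definition C0_semigroup (R : realType) (H : completeNormedModType R[i])
    (T : R -> {linear H -> H}) : Prop :=
  [/\ forall t, 0 <= t -> continuous (T t),
      forall x, T 0 x = x,
      forall s t x, 0 <= s -> 0 <= t -> T (s + t) x = T s (T t x)
    & forall x, T t x @[t --> 0^'+] --> x].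

Definition generator (R : realType) (H : completeNormedModType R[i])
    (T : R -> {linear H -> H}) (L : operator H) : Prop :=
  forall x y, (dom L x /\ L x = y) <->
    ((t^-1)%:C *: (T t x - x) @[t --> 0^'+] --> y).

Definition exponentially_stable (R : realType) (H : completeNormedModType R[i])
    (T : R -> {linear H -> H}) : Prop :=
  exists M w : R, 0 < w /\
    forall t x, 0 <= t -> `|T t x| <= (M * expR (- w * t))%:C * `|x|.

(* (L + mu)^-1, with default value 0 where no preimage exists. *)
Definition shift_inv (R : realType) (H : completeNormedModType R[i])
    (L : operator H) (mu : R[i]) (y : H) : H :=
  xget 0 [set x | dom L x /\ L x + mu *: x = y].

Definition resolvent_set (R : realType) (H : completeNormedModType R[i])
    (L : operator H) : set R[i] :=
  [set z | (forall y, exists! x, dom L x /\ L x + (- z) *: x = y) /\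
           continuous (shift_inv L (- z))].

Definition spectrum (R : realType) (H : completeNormedModType R[i])
    (L : operator H) : set R[i] := ~` resolvent_set L.

Definition eigenvector (R : realType) (H : completeNormedModType R[i])
    (L : operator H) (z : R[i]) (x : H) : Prop :=
  [/\ dom L x, x != 0 & L x = z *: x].

Definition lin_indep (R : realType) (H : completeNormedModType R[i])
    (m : nat) (e : 'I_m -> H) : Prop :=
  forall c : 'I_m -> R[i], \sum_i c i *: e i = 0 -> forall i, c i = 0.

Definition has_dim (R : realType) (H : completeNormedModType R[i])
    (V : set H) (m : nat) : Prop :=
  exists e : 'I_m -> H, lin_indep e /\
    V = [set \sum_i c i *: e i | c in [set: 'I_m -> R[i]]].

Definition complex_integral (R : realType) (a b : R) (f : R -> R[i]) : R[i] :=
  (\int[@lebesgue_measure R]_(t in `[a, b]) complex.Re (f t)) +i*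
  (\int[@lebesgue_measure R]_(t in `[a, b]) complex.Im (f t)).

Definition circle_integral (R : realType) (z : R[i]) (r : R)
    (f : R[i] -> R[i]) : R[i] :=
  let u t := r%:C * (cos t +i* sin t) in
  complex_integral 0 (2 * pi) (fun t => f (z + u t) * ('i * u t)).

(* The Riesz projection (2 pi i)^-1 \oint (w - L)^-1 dw at an isolated point z of
   the spectrum, as a weak integral: (w - L)^-1 = - (L - w)^-1, and the circle
   around z encloses, and meets, no point of the spectrum other than z. *)
Definition riesz_projection (R : realType) (H : completeNormedModType R[i])
    (dot : {dot H for Num.conj}) (L : operator H) (z : R[i]) (x : H) : H :=
  xget 0 [set y | exists r : R,
    [/\ 0 < r,
        forall w, 0 < `|w - z| <= r%:C -> resolvent_set L w
      & forall v, dot y v = (2 * pi%:C * 'i)^-1 *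
          circle_integral z r (fun w => dot (- shift_inv L (- w) x) v)]].

Definition spectral_subspace (R : realType) (H : completeNormedModType R[i])
    (dot : {dot H for Num.conj}) (L : operator H) (z : R[i]) : set H :=
  range (riesz_projection dot L z).

(* The multiplicity of z is algebraic: the rank of its Riesz projection. *)
Definition discrete_spectrum (R : realType) (H : completeNormedModType R[i])
    (dot : {dot H for Num.conj}) (L : operator H) : set R[i] :=
  [set z | [/\ isolated (spectrum L : set (R[i] : numFieldType)) z,
               exists x, eigenvector L z x
             & exists m, has_dim (spectral_subspace dot L z) m]].

Definition essential_spectrum (R : realType) (H : completeNormedModType R[i])
    (dot : {dot H for Num.conj}) (L : operator H) : set R[i] :=
  spectrum L `\` discrete_spectrum dot L.

(* The space associated with the set {lambda j}: each value may be repeated, which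
   does not change the sum of the subspaces. *)
Definition slow_subspace (R : realType) (H : completeNormedModType R[i])
    (dot : {dot H for Num.conj}) (L : operator H) (n : nat)
    (lambda : 'I_n -> R[i]) : set H :=
  [set \sum_j y j | y in
    [set y : 'I_n -> H | forall j, spectral_subspace dot L (lambda j) (y j)]].

Definition diagonalizable_on (R : realType) (H : completeNormedModType R[i])
    (L : operator H) (V : set H) : Prop :=
  forall x, V x -> exists (m : nat) (mu : 'I_m -> R[i]) (e : 'I_m -> H),
    (forall k, V (e k) /\ eigenvector L (mu k) (e k)) /\ x = \sum_k e k.

Definition Gmx (R : realType) (H : completeNormedModType R[i])
    (dot : {dot H for Num.conj}) (n : nat)
    (lambda : 'I_n -> R[i]) (xhat : 'I_n -> H) : 'M[R[i]]_n :=
  \matrix_(i, j) (dot (xhat i) (xhat j) / (lambda i + (lambda j)^*%R)).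

Definition P_DOP (R : realType) (H : completeNormedModType R[i])
    (dot : {dot H for Num.conj}) (L : operator H) (n : nat)
    (lambda : 'I_n -> R[i]) (xhat : 'I_n -> H) (x : H) : H :=
  \sum_(i < n) \sum_(j < n)
    (invmx (Gmx dot lambda xhat)^T i j *
     dot (shift_inv L (lambda j)^*%R x) (xhat j)) *: xhat i.

(* Main.v *)
(* Each slow mode is fixed by P_DOP, because (L + lambda_j^* )^-1 xhat_k is
   xhat_k / (lambda_k + lambda_j^* ), so that the inner products appearing in
   P_DOP xhat_k form the k-th column of G^T; as P_DOP maps into the span of the
   slow modes, it is a projection. The matrix G is invertible because it solves
   the Lyapunov equation D G + G D^* = M, with D the diagonal matrix of the
   lambda_j and M the Gram matrix of the slow modes: if v G = 0 then also
   G v^* = 0, G being Hermitian, hence v M v^* = 0 and v = 0. *)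
Require Import Defs.
From HB Require Import structures.
From mathcomp Require Import all_boot all_order all_algebra.
From mathcomp Require Import all_classical all_reals all_analysis.
From mathcomp Require Import complex ring.
Import Order.TTheory GRing.Theory Num.Theory.
Import numFieldNormedType.Exports.
Local Open Scope classical_set_scope.
Local Open Scope ring_scope.
Local Open Scope complex_scope.

(** Conjugation preserves the real part, so the sum has negative real part. This keeps the
    denominators of [Gmx] away from zero. *)
Lemma addC_conj_neq0 (R : realType) (z w : R[i]) :
  complex.Re z < 0 -> complex.Re w < 0 -> z + w^*%R != 0.
Proof.
case: z w => [a b] [c d] /= a_lt0 c_lt0.
rewrite eq_complex /= negb_and; apply/orP; left.
by rewrite lt_eqF // -[ltRHS]addr0 ltrD.
Qed.

Section SlowModes.
Context (R : realType) (H : completeNormedModType R[i]).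
Context (dot : {dot H for Num.conj}) (L : operator H).
Context (n : nat) (lambda : 'I_n -> R[i]) (xhat : 'I_n -> H).

Lemma dom_op_sum (c : 'I_n -> R[i]) (x : 'I_n -> H) :
  (forall i, dom L (x i)) ->
  dom L (\sum_i c i *: x i) /\ L (\sum_i c i *: x i) = \sum_i c i *: L (x i).
Proof.
move=> domx; elim/big_rec2: _ => [|i y2 y1 _ [dom1 L1]].
  split; first exact: dom0.
  (* [L 0 = 0] comes from linearity at [-1 *: 0 + 0]. *)
  by have := opP (-1) (dom0 L) (dom0 L); rewrite !scaleN1r oppr0 addr0 addNr.
split; first exact: domP.
by rewrite opP // L1.
Qed.

(** [L + mu] is [L - z] at [z = - mu]; for [z] in the resolvent set the preimage is unique, so
    [xget] returns it and never its default 0. *)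
Lemma shift_inv_eq (mu : R[i]) (x : H) :
  resolvent_set L (- mu) -> dom L x -> shift_inv L mu (L x + mu *: x) = x.
Proof.
case=> uniq_sol _ domx; apply: xget_unique => //= y soly.
have [z [_ zP]] := uniq_sol (L x + mu *: x); rewrite opprK in zP.
by rewrite -(zP x) // -(zP y).
Qed.

Hypothesis denom_neq0 : forall i j, lambda i + (lambda j)^*%R != 0.

Lemma Gmx_conj i j :
  (Gmx dot lambda xhat i j)^*%R = Gmx dot lambda xhat j i.
Proof.
rewrite !mxE fmorph_div rmorphD /= conjCK [X in _ / X]addrC.
by rewrite (hermC dot (xhat j)) expr0 mul1r.
Qed.

Lemma Gmx_unit : lin_indep xhat -> Gmx dot lambda xhat \in unitmx.
Proof.
move=> xhat_indep; rewrite -row_free_unit; apply: inj_row_free => v vG0.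
set G := Gmx dot lambda xhat in vG0 *.
have vG j : \sum_i v 0 i * G i j = 0.
  by move/rowP: vG0 => /(_ j); rewrite !mxE.
have Gv i : \sum_j (v 0 j)^*%R * G i j = 0.
  apply: (can_inj (@conjCK _)); rewrite rmorph0 -[RHS](vG i) rmorph_sum /=.
  by apply: eq_bigr => j _; rewrite rmorphM /= conjCK Gmx_conj.
have GramE i j : dot (xhat i) (xhat j) = (lambda i + (lambda j)^*%R) * G i j.
  by rewrite mxE mulrC divfK.
set x := \sum_i v 0 i *: xhat i.
have dotx0 : dot x x = 0.
  (* The weight [lambda i + (lambda j)^*] is split so that the first term vanishes when summed over
     [j], by [Gv], and the second when summed over [i], by [vG]. *)
  transitivity (\sum_i \sum_j
      (v 0 i * lambda i * ((v 0 j)^*%R * G i j) +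
       (v 0 j)^*%R * (lambda j)^*%R * (v 0 i * G i j))).
    rewrite {1}/x linear_sumlz; apply: eq_bigr => i _.
    rewrite linearZl_LR /x linear_sumr mulr_sumr; apply: eq_bigr => j _.
    by rewrite linearZr_LR /= GramE; ring.
  under eq_bigr => i _ do rewrite big_split /= -mulr_sumr Gv mulr0 add0r.
  by rewrite exchange_big big1 // => j _; rewrite -mulr_sumr vG mulr0.
have x0 : x = 0.
  by apply/eqP; apply: contraPT dotx0 => /(neq0_dnorm_gt0 (s := dot)) /gt_eqF/eqP.
by apply/rowP => i; rewrite mxE; apply: xhat_indep x0 i.
Qed.

Hypothesis conj_resolvent : forall j, resolvent_set L (- (lambda j)^*%R).
Hypothesis xhat_eigen : forall j, eigenvector L (lambda j) (xhat j).

Lemma shift_inv_slow (c : 'I_n -> R[i]) j :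
  shift_inv L (lambda j)^*%R (\sum_k c k *: xhat k) =
  \sum_k (c k / (lambda k + (lambda j)^*%R)) *: xhat k.
Proof.
have domx k : dom L (xhat k) by case: (xhat_eigen k).
have [domy Ly] :=
  dom_op_sum (fun k => c k / (lambda k + (lambda j)^*%R)) xhat domx.
(* It suffices that [L + (lambda j)^*] maps the claimed preimage to the given combination; on each
   mode it multiplies by the denominator. *)
rewrite -[RHS](shift_inv_eq _ _ (conj_resolvent j) domy); congr shift_inv.
rewrite Ly scaler_sumr -big_split; apply: eq_bigr => k _ /=.
have [_ _ ->] := xhat_eigen k.
by rewrite !scalerA -scalerDl [_^*%R * _]mulrC -mulrDr divfK.
Qed.

Lemma P_DOP_slow (c : 'I_n -> R[i]) : lin_indep xhat ->
  P_DOP dot L lambda xhat (\sum_k c k *: xhat k) = \sum_k c k *: xhat k.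
Proof.
move=> xhat_indep; set G := Gmx dot lambda xhat.
have GT_unit : G^T \in unitmx by rewrite unitmx_tr Gmx_unit.
(* The k-th term is [c k] times the entry [(k, j)] of G, hence the transpose, which [invmx G^T] then
   cancels. *)
have dotE j : dot (shift_inv L (lambda j)^*%R (\sum_k c k *: xhat k)) (xhat j)
    = (G^T *m \col_k c k) j 0.
  rewrite shift_inv_slow linear_sumlz mxE; apply: eq_bigr => k _.
  by rewrite linearZl_LR !mxE /=; ring.
apply: eq_bigr => i _; rewrite -scaler_suml; congr (_ *: _).
under eq_bigr => j _ do rewrite dotE.
transitivity ((invmx G^T *m (G^T *m \col_k c k)) i 0); first by rewrite [RHS]mxE.
by rewrite mulKmx // mxE.
Qed.

End SlowModes.

Theorem proposition2 (R : realType) (H : completeNormedModType R[i])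
  (dot : {dot H for Num.conj}) (dot_norm : induces_norm dot)
  (L : operator H) (L_closed : closed_operator L)
  (T : R -> {linear H -> H}) (T_semigroup : C0_semigroup T)
  (L_generator : generator T L) (T_stable : exponentially_stable T)
  (spec_neg : forall z, spectrum L z -> complex.Re z < 0)
  (n : nat) (lambda : 'I_n -> R[i])
  (spec_split : spectrum L = essential_spectrum dot L `|` range lambda)
  (lambda_discrete : forall j, discrete_spectrum dot L (lambda j))
  (lambda_mult : forall j,
    has_dim (spectral_subspace dot L (lambda j))
            #|[set i : 'I_n | lambda i == lambda j]%SET|)
  (lambda_ordered : forall i j : 'I_n, (i < j)%N ->
    complex.Re (lambda i) <= complex.Re (lambda j))
  (spec_gap : forall z j, essential_spectrum dot L z ->
    complex.Re z < complex.Re (lambda j))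
  (slow_diag : diagonalizable_on L (slow_subspace dot L lambda))
  (xhat : 'I_n -> H) (xhat_indep : lin_indep xhat)
  (xhat_eigen : forall j, eigenvector L (lambda j) (xhat j)) :
  P_DOP dot L lambda xhat \o P_DOP dot L lambda xhat = P_DOP dot L lambda xhat.
Proof.
have Re_lambda j : complex.Re (lambda j) < 0.
  by apply: spec_neg; rewrite spec_split; right; exists j.
have denom_neq0 i j : lambda i + (lambda j)^*%R != 0.
  exact: addC_conj_neq0.
(* This point has positive real part, so it lies outside the spectrum. *)
have conj_resolvent j : resolvent_set L (- (lambda j)^*%R).
  apply: contrapT => /spec_neg; rewrite raddfN /= oppr_lt0 ltNge; apply/negP; rewrite negbK.
  by case: (lambda j) (Re_lambda j) => a b /= /ltW.
apply/funext => x /=.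
(* Only the inner application and the right-hand side are unfolded: both become the same combination
   of slow modes, which the outer [P_DOP] fixes. *)
rewrite {2 3}/P_DOP.
under eq_bigr => i _ do rewrite -scaler_suml.
exact: P_DOP_slow.
Qed.
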